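(* Let $X$ be a set and let $\prec$ be a neighbourhood operator on $X$ satisfying axioms (N0), (N1), (N2), (N3). Then $\prec$ satisfies (N4) if and only if for every subset $A\subseteq X$ and every function $f: A \rightarrow [-2, 2]$ which is neighbourhood continuous with respect to the operator $\prec_A$ induced by $\prec$ on $A$ and the topological neighbourhood operator on $[-2,2]$, there is a neighbourhood continuous function $g: X \rightarrow [-2,2]$ (with respect to $\prec$ and the topological neighbourhood operator on $[-2,2]$) which extends $f$.
   Context: A neighbourhood operator on a set $X$ is a binary relation $\prec$ on the power set of $X$ such that $A \prec B$ implies $A \subseteq B$. Axioms: (N0) $A \prec X$ for all $A \subseteq X$. (N1) If $A \prec B$ then $X \setminus B \prec X \setminus A$. (N2) If $A \prec B \subseteq C$, then $A \prec C$. (N3) If $A \prec N$ and $A' \prec N'$ then $A \cup A' \prec N \cup N'$. (N4) For every pair of subsets $A \prec C$, there is a subset $B$ with $A \prec B \prec C$. If $X,Y$ are sets with neighbourhood operators $\prec_X,\prec_Y$, a map $f:X\to Y$ is neighbourhood continuous if $A \prec_Y B$ implies $f^{-1}(A) \prec_X f^{-1}(B)$ for all $A,B\subseteq Y$. The topological neighbourhood operator on a topological space is defined by: $A \prec B$ if and only if $B$ contains an open set containing $\mathrm{cl}(A)$. For $A\subseteq X$, the induced neighbourhood operator $\prec_A$ on subsets of $A$ is: $S \prec_A T$ precisely when there is a subset $T'$ of $X$ such that $S \prec T'$ and $T = T' \cap A$. *)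

(* Defs.v *)
From mathcomp Require Import all_boot all_order all_algebra.
From mathcomp Require Import all_classical all_reals all_analysis.

Set Implicit Arguments.
Unset Strict Implicit.
Unset Printing Implicit Defensive.

Import Order.TTheory GRing.Theory Num.Theory.
Import numFieldNormedType.Exports.

Local Open Scope classical_set_scope.
Local Open Scope ring_scope.

Definition neighbourhood_operator (X : Type) (r : set X -> set X -> Prop) : Prop :=
  forall A B : set X, r A B -> A `<=` B.

Definition N0 (X : Type) (r : set X -> set X -> Prop) : Prop :=
  forall A : set X, r A setT.

Definition N1 (X : Type) (r : set X -> set X -> Prop) : Prop :=
  forall A B : set X, r A B -> r (~` B) (~` A).

Definition N2 (X : Type) (r : set X -> set X -> Prop) : Prop :=
  forall A B C : set X, r A B -> B `<=` C -> r A C.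

Definition N3 (X : Type) (r : set X -> set X -> Prop) : Prop :=
  forall A N A' N' : set X, r A N -> r A' N' -> r (A `|` A') (N `|` N').

Definition N4 (X : Type) (r : set X -> set X -> Prop) : Prop :=
  forall A C : set X, r A C -> exists B : set X, r A B /\ r B C.

Definition neighbourhood_continuous (X Y : Type)
    (rX : set X -> set X -> Prop) (rY : set Y -> set Y -> Prop)
    (f : X -> Y) : Prop :=
  forall A B : set Y, rY A B -> rX (f @^-1` A) (f @^-1` B).

Definition topological_neighbourhood (T : topologicalType) (A B : set T) : Prop :=
  exists U : set T, [/\ open U, closure A `<=` U & U `<=` B].
Arguments topological_neighbourhood T A B : clear implicits.

(* Subsets of [A] are sets over the subtype [set_type A]: [set_val @` S] is
   [S] seen as a subset of [X], and [set_val @^-1` T'] is the intersection of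
   [T'] with [A]. *)
Definition induced_neighbourhood (X : Type) (r : set X -> set X -> Prop)
    (A : set X) (S T : set (set_type A)) : Prop :=
  exists T' : set X, r (set_val @` S) T' /\ T = set_val @^-1` T'.
Arguments induced_neighbourhood {X} r A S T.

(* [set_type (interval22 R)] carries the subspace topology of [R]. *)
Definition interval22 (R : realType) : set R := `[-2, 2].
Arguments interval22 R : clear implicits.

(* Main.v *)
(* A neighbourhood operator satisfying (N0)-(N4) supports the Katetov-Tong
   insertion argument.  Write < for the operator.  Given f on A, let
   F_p = {f <= p} and let G_q be the complement of {f >= q}; then F_p < G_q
   whenever p < q.  Running through the rationals one inserts sets u_c with
   u_c < u_d for c < d and F_p < u_c < G_q for p < c < q, and then
   g(x) = inf {c | x in u_c}, truncated to [-2, 2], extends f.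
   Conversely, for A < C, extend the function equal to -2 on A and to 2 off C,
   and interpolate by {g < 0}. *)

Require Import Defs.
From mathcomp Require Import all_boot all_order all_algebra.
From mathcomp Require Import all_classical all_reals all_analysis.
From mathcomp Require Import lra.

Import Order.TTheory GRing.Theory Num.Theory.
Import numFieldNormedType.Exports.

Local Open Scope classical_set_scope.
Local Open Scope ring_scope.

Set Implicit Arguments.
Unset Strict Implicit.

(** Dependent choice on the whole history. Since [P n] looks only at entries below [n], a finite
    list padded with [t0] can stand for the sequence built so far. *)
Lemma strong_recursion (T : Type) (P : nat -> (nat -> T) -> T -> Prop) :
  inhabited T ->
  (forall n u v t, (forall i, (i < n)%N -> u i = v i) -> P n u t -> P n v t) ->
  (forall n u, (forall i, (i < n)%N -> P i u (u i)) -> exists t, P n u t) ->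
  exists u, forall n, P n u (u n).
Proof.
move=> [t0] Pext Pex.
have /choice[next nextP] (w : nat * (nat -> T)) :
    exists t, (exists t', P w.1 w.2 t') -> P w.1 w.2 t.
  have [[t Pt]|nP] := pselect (exists t', P w.1 w.2 t'); first by exists t.
  by exists t0 => /nP.
pose s := fix s n := if n is m.+1 then rcons (s m) (next (m, nth t0 (s m)))
                     else [::].
have size_s n : size (s n) = n by elim: n => //= n IHn; rewrite size_rcons IHn.
pose u n := nth t0 (s n.+1) n.
have nth_s n i : (i < n)%N -> nth t0 (s n) i = u i.
  elim: n => // n IHn; rewrite ltnS leq_eqVlt => /predU1P[->//|ltin].
  by rewrite /= nth_rcons size_s ltin IHn.
have uE n : u n = next (n, nth t0 (s n)).
  by rewrite /u /= nth_rcons size_s ltnn eqxx.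
exists u => n; elim/ltn_ind: n => n IHn.
have [t Pt] := Pex n u IHn.
have nth_sE i : (i < n)%N -> nth t0 (s n) i = u i by exact: nth_s.
apply: (Pext n (nth t0 (s n))) => //; rewrite uE.
apply: (nextP (n, nth t0 (s n))); exists t => /=.
by apply: Pext Pt => i lt_in; rewrite nth_sE.
Qed.

(** * Calculus of neighbourhood operators and countable insertion *)

Section NeighbourhoodOperator.
Context (X : Type) (r : set X -> set X -> Prop).
Hypotheses (r_nbhd : neighbourhood_operator r)
  (r_N0 : N0 r) (r_N1 : N1 r) (r_N2 : N2 r) (r_N3 : N3 r).

Lemma nbhd_subl (A A' B : set X) : A' `<=` A -> r A B -> r A' B.
Proof.
move=> A'A /r_N1 rBA; rewrite -[A']setCK -[B]setCK; apply: r_N1.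
by apply: r_N2 rBA _; exact: subsetC.
Qed.

Lemma nbhd0 (B : set X) : r set0 B.
Proof. by rewrite -[B]setCK -setCT; apply: r_N1; exact: r_N0. Qed.

Lemma nbhdUl (A A' B : set X) : r A B -> r A' B -> r (A `|` A') B.
Proof. by move=> rAB /(r_N3 rAB); rewrite setUid. Qed.

Lemma nbhdI (A N A' N' : set X) : r A N -> r A' N' -> r (A `&` A') (N `&` N').
Proof.
move=> /r_N1 rNA /r_N1 rNA'; have := r_N1 (r_N3 rNA rNA').
by rewrite !setCU !setCK.
Qed.

Lemma nbhdIr (A B B' : set X) : r A B -> r A B' -> r A (B `&` B').
Proof. by move=> rAB /(nbhdI rAB); rewrite setIid. Qed.

Lemma nbhd_bigUl (I : Type) (s : seq I) (P : pred I) (F : I -> set X) B :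
  (forall i, P i -> r (F i) B) -> r (\big[setU/set0]_(i <- s | P i) F i) B.
Proof.
by apply: (big_ind (r^~ B)); [exact: nbhd0|move=> ? ?; exact: nbhdUl].
Qed.

Lemma nbhd_bigIr (I : Type) (s : seq I) (P : pred I) (F : I -> set X) A :
  (forall i, P i -> r A (F i)) -> r A (\big[setI/setT]_(i <- s | P i) F i).
Proof.
by apply: (big_ind (r A)); [exact: r_N0|move=> ? ?; exact: nbhdIr].
Qed.

Hypothesis r_N4 : N4 r.

(* Although r is only stable under finite unions, a countable union of sets N_k
   can be inserted: the N_k increase, the bounds M_k decrease, and Poo, Qoo keep
   all the infinitely many later requirements satisfiable at each step. *)
Lemma nbhd_interpolation (P Q : nat -> set X) (Poo Qoo : set X) :
  (forall k, P k `<=` Poo) -> (forall k, Qoo `<=` Q k) ->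
  (forall k, r (P k) Qoo) -> (forall k, r Poo (Q k)) ->
  exists U, forall k, r (P k) U /\ r U (Q k).
Proof.
move=> PPoo QooQ rPQoo rPooQ.
pose inv (S : set X * set X) := [/\ r S.1 S.2, r S.1 Qoo & r Poo S.2].
pose succ k (S S' : set X * set X) := [/\ inv S', S.1 `<=` S'.1, S'.2 `<=` S.2,
  r (P k) S'.1 & r S'.2 (Q k)].
have /choice[next nextP] (w : nat * (set X * set X)) :
    exists S, inv w.2 -> succ w.1 w.2 S.
  case: w => k [N M].
  have [[/= rNM rNQ rPM]|ninv] := pselect (inv (N, M)); last by exists (N, M).
  (* The upper bound [M'] comes first and stays above [Poo], hence above every later [P k]; [N'] is
     then fitted below both [M'] and [Qoo]. *)
  have [M' [rM' rM'MQ]] : exists M', r (Poo `|` N) M' /\ r M' (M `&` Q k).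
    apply: r_N4; apply: nbhdUl; apply: nbhdIr => //.
    exact: r_N2 rNQ (QooQ k).
  have rPM' : r Poo M' by apply: nbhd_subl rM'; exact: subsetUl.
  have rNM' : r N M' by apply: nbhd_subl rM'; exact: subsetUr.
  have [N' [rN' rN'M]] : exists N', r (P k `|` N) N' /\ r N' (M' `&` Qoo).
    apply: r_N4; apply: nbhdUl; apply: nbhdIr => //.
    exact: nbhd_subl (PPoo k) _.
  exists (N', M') => _; split => /=.
  - split => //=.
    + by apply: r_N2 rN'M _; exact: subIsetl.
    + by apply: r_N2 rN'M _; exact: subIsetr.
  - by apply: subset_trans (r_nbhd rN'); exact: subsetUr.
  - by apply: subset_trans (r_nbhd rM'MQ) _; exact: subIsetl.
  - by apply: nbhd_subl rN'; exact: subsetUl.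
  - by apply: r_N2 rM'MQ _; exact: subIsetr.
pose s := fix s n := if n is m.+1 then next (m, s m) else (set0, setT).
have s_inv n : inv (s n).
  elim: n => [|n IHn]; first by split; [exact: nbhd0|exact: nbhd0|exact: r_N0].
  by have [] := nextP (n, s n) IHn.
have s_succ n : succ n (s n) (s n.+1) by exact: nextP (n, s n) (s_inv n).
have s_mono m n : (m <= n)%N -> (s m).1 `<=` (s n).1 /\ (s n).2 `<=` (s m).2.
  elim: n => [|n IHn]; first by rewrite leqn0 => /eqP ->; split.
  rewrite leq_eqVlt => /predU1P[->|/IHn[sN sM]]; first by split.
  have [_ sN' sM' _ _] := s_succ n.
  by split; [exact: subset_trans sN sN'|exact: subset_trans sM' sM].
(* Stage [k] treats [P k] and [Q k], hence the index [k.+1]; a lower set and an upper set from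
   different stages are compared at the later one. *)
exists (\bigcup_n (s n).1) => k; have [_ _ _ rP rQ] := s_succ k.
split; first by apply: r_N2 rP _ => x ?; exists k.+1.
apply: nbhd_subl rQ => x [n _ sx].
have [sN _] := s_mono n (maxn n k.+1) (leq_maxl _ _).
have [_ sM] := s_mono k.+1 (maxn n k.+1) (leq_maxr _ _).
have [rs _ _] := s_inv (maxn n k.+1).
exact/sM/(r_nbhd rs)/sN.
Qed.

(** The [u n] are chosen one at a time. Earlier sets impose finitely many conditions, merged into
    [V] and [W]; by monotonicity, the conditions from [F] and [G] need only be met along
    [q - 1/(k+1)] and [q + 1/(k+1)]. *)
Lemma nbhd_insertion (R : realType) (F G : R -> set X) (e : nat -> R) :
  (forall p q, p <= q -> F p `<=` F q) ->
  (forall p q, p <= q -> G p `<=` G q) ->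
  (forall p q, p < q -> r (F p) (G q)) ->
  exists u : nat -> set X,
    [/\ forall i j, e i < e j -> r (u i) (u j),
        forall i p, p < e i -> r (F p) (u i) &
        forall i q, e i < q -> r (u i) (G q)].
Proof.
move=> F_mono G_mono rFG.
pose fits n u U :=
  [/\ forall i : nat, (i < n)%N -> e i < e n -> r (u i) U,
      forall i : nat, (i < n)%N -> e n < e i -> r U (u i),
      forall p, p < e n -> r (F p) U & forall q, e n < q -> r U (G q)].
have [|||u uP] := @strong_recursion (set X) fits.
- by split; exact: set0.
- move=> n u v U uv [h1 h2 h3 h4]; split => // i ltin.
    by rewrite -uv//; exact: h1.
  by rewrite -uv//; exact: h2.
- move=> n u uP; pose q := e n.
  pose V := \big[setU/set0]_(i < n | e i < q) u i.
  pose W := \big[setI/setT]_(i < n | q < e i) u i.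
  have rV B : (forall i : 'I_n, e i < q -> r (u i) B) -> r V B.
    exact: nbhd_bigUl.
  have rW B : (forall i : 'I_n, q < e i -> r B (u i)) -> r B W.
    exact: nbhd_bigIr.
  have rVW : r V W.
    apply: rV => i ltiq; apply: rW => j ltqj.
    have ltij := lt_trans ltiq ltqj.
    have : (i != j :> nat).
      by apply: contraTneq ltij => ->; rewrite ltxx.
    rewrite neq_ltn => /orP[lt|lt].
      by have [h _ _ _] := uP j (ltn_ord j); exact: h.
    by have [_ h _ _] := uP i (ltn_ord i); exact: h.
  have rVG p : q <= p -> r V (G p).
    move=> qp; apply: rV => i iq; have [_ _ _ h] := uP i (ltn_ord i).
    by apply: h; exact: lt_le_trans qp.
  have rFW p : p <= q -> r (F p) W.
    move=> qp; apply: rW => i iq; have [_ _ h _] := uP i (ltn_ord i).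
    by apply: h; exact: le_lt_trans iq.
  have ltdq k : q - k.+1%:R^-1 < q by rewrite ltrBlDr ltrDl.
  have ltqd k : q < q + k.+1%:R^-1 by rewrite ltrDl.
  (* [F q] and [G q] need not be related to each other, only each of them to the shifted sets of the
     other family, which is the pattern [nbhd_interpolation] handles. *)
  have [||||U UP] := @nbhd_interpolation
    (fun k => F (q - k.+1%:R^-1) `|` V) (fun k => G (q + k.+1%:R^-1) `&` W)
    (F q `|` V) (G q `&` W).
  + by move=> k; apply: setSU; apply: F_mono; exact: ltW.
  + by move=> k; apply: setSI; apply: G_mono; exact: ltW.
  + move=> k; apply: nbhdUl; apply: nbhdIr => //; first exact: rFG.
      by apply: rFW; exact: ltW.
    exact: rVG.
  + move=> k; apply: nbhdUl; apply: nbhdIr => //; first exact: rFG.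
      exact: rFW.
    by apply: rVG; exact: ltW.
  have rVU : r V U by apply: nbhd_subl (UP 0).1; exact: subsetUr.
  have rUW : r U W by apply: r_N2 (UP 0).2 _; exact: subIsetr.
  exists U; split.
  + move=> i ltin ltiq; apply: nbhd_subl rVU.
    by rewrite /V (bigD1 (Ordinal ltin))//=; exact: subsetUl.
  + move=> i ltin ltiq; apply: r_N2 rUW _.
    by rewrite /W (bigD1 (Ordinal ltin))//=; exact: subIsetl.
  + move=> p /ltr_add_invr[k pk]; apply: nbhd_subl (UP k).1.
    apply: subset_trans (@subsetUl _ _ _); apply: F_mono.
    by rewrite lerBrDr ltW.
  + move=> p /ltr_add_invr[k pk]; apply: r_N2 (UP k).2 _.
    apply: subset_trans (@subIsetl _ _ _) _; apply: G_mono.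
    exact: ltW.
- exists u; split; last 2 first.
  + by move=> i; have [] := uP i.
  + by move=> i; have [] := uP i.
  + move=> i j ltij; have : (i != j :> nat).
      by apply: contraTneq ltij => ->; rewrite ltxx.
    rewrite neq_ltn => /orP[lt|lt].
      by have [h _ _ _] := uP j; exact: h.
    by have [_ h _ _] := uP i; exact: h.
Qed.

End NeighbourhoodOperator.

(** * Continuity into the interval, tested on sublevel sets *)

Section IntervalValued.
Context (R : realType).
Local Notation I := (set_type (interval22 R)).

Lemma interval22_open (V0 : set R) :
  open V0 -> open (set_val @^-1` V0 : set I).
Proof. by move=> oO; exists V0. Qed.

Lemma interval22_closed (V0 : set R) :
  closed V0 -> closed (set_val @^-1` V0 : set I).
Proof.
move=> cO; rewrite -openC preimage_setC.
by apply: interval22_open; rewrite openC.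
Qed.

Lemma neighbourhood_continuous_lelt (X : Type) (r : set X -> set X -> Prop)
    (f : X -> I) (p q : R) :
  neighbourhood_continuous r (topological_neighbourhood I) f -> p < q ->
  r [set x | set_val (f x) <= p] [set x | set_val (f x) < q].
Proof.
move=> fC ltpq; apply: (fC (set_val @^-1` [set t | t <= p])
                         (set_val @^-1` [set t | t < q])).
exists (set_val @^-1` [set t | t < q]); split => //.
  by apply: interval22_open; exact: open_lt.
apply: (@subset_trans _ (set_val @^-1` [set t : R | t <= p])).
  exact: (interval22_closed (@closed_le _ p)).
move=> t /= /le_lt_trans; exact.
Qed.

(** Used for the extension [g], an infimum, of which only sublevel sets are easy to control.
    Compactness of the interval passes from these to arbitrary pairs. *)
Lemma lelt_neighbourhood_continuous (X : Type) (r : set X -> set X -> Prop)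
    (f : X -> I) :
  N0 r -> N1 r -> N2 r -> N3 r ->
  (forall p q : R, p < q ->
    r [set x | set_val (f x) <= p] [set x | set_val (f x) < q]) ->
  neighbourhood_continuous r (topological_neighbourhood I) f.
Proof.
move=> r_N0 r_N1 r_N2 r_N3 f_lelt S T [U [[V0 oO OU] clSU UT]].
have [//|nST] := pselect (r (f @^-1` S) (f @^-1` T)).
(* [F V] says that the part of [S] outside [V] is harmless; harmless parts form an ideal. *)
pose F (V : set R) := r (f @^-1` (S `&` (set_val @^-1` ~` V))) (f @^-1` T).
have sub V V' : V `<=` V' -> F V -> F V'.
  move=> VV'; apply: nbhd_subl => // x /= [Sx nV]; split => // V'x.
  by apply: nV; exact: VV'.
(* If the conclusion fails, F is a proper filter; being carried by the compact
   interval it clusters at a point of the closure of S, which a small ball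
   around that point contradicts. *)
have FF : ProperFilter F.
  split.
    move=> F0; apply: nST; apply: nbhd_subl F0 => // x Sx.
    by split => //; case.
  split.
  - rewrite /F; have -> : f @^-1` (S `&` (set_val @^-1` ~` setT)) = set0.
      by apply/seteqP; split => // x [_] /=; exact.
    exact: nbhd0.
  - move=> V W FV FW; apply: nbhd_subl (nbhdUl r_N3 FV FW) => //.
    move=> x [Sx /= nVW]; have [Vx|] := pselect (V (set_val (f x))); last by left.
    by right; split => // Wx; exact: nVW.
  - exact: sub.
have FI : F (interval22 R).
  have F1 : F setT by exact: filterT.
  apply: nbhd_subl F1 => // x [Sx /=]; case.
  exact: set_valP.
have [s [Is sF]] := segment_compact FF FI.
have memI : s \in interval22 R by rewrite inE.
pose s' : I := SigSub memI.
have Us' : U s'.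
  (* No point of [S] lies outside the image of [S], so that image is in [F] and every neighbourhood
     of [s] meets it. *)
  apply: clSU => B [B' [[B0 oB0 <-] B0s sub0]].
  have FS : F (set_val @` S).
    have F1 : F setT by exact: filterT.
    apply: nbhd_subl F1 => // x [Sx /=]; case.
    by exists (f x).
  have [_ [[t St <-] B0t]] := sF _ _ FS (open_nbhs_nbhs (conj oB0 B0s)).
  exists t; split => //; exact: sub0.
have Os : nbhs s V0.
  by apply: open_nbhs_nbhs; split => //; move: Us'; rewrite -OU.
have /nbhs_ballP[d /= d0 dO] := Os.
(* The part of [S] in the half ball is harmless: its band is related to the band of half-width [d],
   whose preimage lies in that of [T]. Upper bounds come from [f_lelt], lower bounds from it through
   (N1). *)
have Fd : F (~` ball s (d / 2)).
  have rlt : r [set x | s - d / 2 < set_val (f x) < s + d / 2]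
               [set x | s - d < set_val (f x) < s + d].
    have d2 : d / 2 < d by rewrite ltr_pdivrMr// mulr_natr mulr2n ltrDl.
    have r1 : r [set x | set_val (f x) <= s + d / 2]
                [set x | set_val (f x) < s + d].
      by apply: f_lelt; rewrite ltrD2l.
    have r2 : r (~` [set x | set_val (f x) < s - d / 2])
                (~` [set x | set_val (f x) <= s - d]).
      by apply: r_N1; apply: f_lelt; rewrite ltrD2l ltrN2.
    have := nbhdI r_N1 r_N3 r2 r1 => rr.
    apply: r_N2 (nbhd_subl r_N1 r_N2 _ rr) _ => //.
    - by move=> x /= /andP[/ltW h /ltW h']; split => //; apply/negP; rewrite -leNgt.
    - by move=> x /= [/negP]; rewrite -ltNge => -> ->.
  apply: r_N2 (nbhd_subl r_N1 r_N2 _ rlt) _ => //.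
    move=> x [_ /= /contrapT]; rewrite /ball/= ltr_norml => /andP[h1 h2].
    by apply/andP; split; lra.
  move=> x /= /andP[h1 h2]; apply: UT; rewrite -OU; apply: dO.
  by rewrite /ball/= ltr_norml; apply/andP; split; lra.
have d20 : 0 < d / 2 by rewrite divr_gt0.
by have [t [nt /nt]] := sF _ _ Fd (nbhsx_ballx s _ d20).
Qed.

End IntervalValued.

(** * From interpolation to extension *)

Lemma extension_of_interpolation (R : realType) (X : Type)
    (r : set X -> set X -> Prop) (A : set X)
    (f : set_type A -> set_type (interval22 R)) :
  neighbourhood_operator r -> N0 r -> N1 r -> N2 r -> N3 r -> N4 r ->
  neighbourhood_continuous (induced_neighbourhood r A)
    (topological_neighbourhood (set_type (interval22 R))) f ->
  exists g : X -> set_type (interval22 R),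
    neighbourhood_continuous r
      (topological_neighbourhood (set_type (interval22 R))) g /\
    (forall a : set_type A, g (set_val a) = f a).
Proof.
move=> r_nbhd r_N0 r_N1 r_N2 r_N3 r_N4 fC.
(* A point off [A] is in no [F p] and in every [G q], so it imposes no constraint. *)
pose F p := set_val @` [set a | set_val (f a) <= p].
pose G q := [set x | forall a, set_val a = x -> set_val (f a) < q].
have rFG p q : p < q -> r (F p) (G q).
  move=> /(neighbourhood_continuous_lelt fC)[T' [rT' T'E]].
  apply: r_N2 rT' _ => x T'x a ax.
  suff : (set_val @^-1` T') a by rewrite -T'E.
  by rewrite /preimage /= ax.
(* An enumeration of the rationals; a number coding none is sent to 0, which merely repeats a
   value. *)
pose e n : R := ratr (odflt 0 (unpickle n)).
have e_dense p q : p < q -> exists i, p < e i < q.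
  move=> /rat_in_itvoo[c]; rewrite in_itv/= => pcq.
  by exists (pickle c); rewrite /e pickleK.
have [||//|u [u_mono Fu uG]] :=
  @nbhd_insertion _ _ r_nbhd r_N0 r_N1 r_N2 r_N3 r_N4 R F G e.
- by move=> p q pq _ [a /= ap <-]; exists a => //=; exact: le_trans pq.
- by move=> p q pq x Gx a /Gx /lt_le_trans; exact.
(* The value 2 keeps the infimum away from the junk value of an empty set. *)
pose S x := [set t | t = 2 \/ exists i, [/\ u i x, -2 <= e i <= 2 & t = e i]].
have S2 x : S x 2 by left.
have S_ge x : lbound (S x) (-2).
  by move=> t [->|[i [_ /andP[? _] ->]]] //; lra.
have infS_le x t : S x t -> inf (S x) <= t.
  by move=> Sxt; apply: ge_inf => //; exists (-2).
have infSI x : inf (S x) \in interval22 R.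
  rewrite inE /interval22 /= in_itv /=; apply/andP; split; last exact: infS_le.
  by apply: lb_le_inf => //; exists 2.
pose g x : set_type (interval22 R) := SigSub (infSI x).
exists g; split.
- apply: lelt_neighbourhood_continuous => // p q pq.
  have [p2|p2] := leP 2 p.
    apply: r_N2 (r_N0 _) _ => x _; apply: le_lt_trans (infS_le x 2 (S2 x)) _.
    exact: le_lt_trans pq.
  have [pN2|pN2] := ltP p (-2).
    apply: nbhd_subl (nbhd0 r_N0 r_N1 _) => // x /= gp.
    have := lb_le_inf (ex_intro _ 2 (S2 x)) (@S_ge x).
    by move=> /le_trans /(_ gp); rewrite leNgt pN2.
  (* The minimum with 2 makes [e j] an admissible element of [S x], and rules out the element 2 when
     [g x] is below [e i]. *)
  have pm : p < Num.min q 2 by rewrite lt_min pq.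
  have [j /andP[pj]] := e_dense _ _ pm; rewrite lt_min => /andP[jq j2].
  have [i /andP[pi ij]] := e_dense _ _ pj.
  apply: r_N2 (nbhd_subl r_N1 r_N2 _ (u_mono _ _ ij)) _.
    move=> x /= /le_lt_trans /(_ pi) /inf_lt[|t]; first by exists 2.
    case=> [->|[k [ukx _ ->]]] ltki; first by exfalso; lra.
    exact: r_nbhd (u_mono _ _ ltki) _ ukx.
  move=> x /= ujx; apply: le_lt_trans jq; apply: infS_le; right; exists j.
  by split => //; apply/andP; split; lra.
- move=> a; apply: val_inj => /=.
  have : interval22 R (set_val (f a)) by exact: set_valP.
  rewrite /interval22 /= in_itv /= => /andP[fa_ge fa_le].
  apply/eqP; rewrite eq_le; apply/andP; split.
    rewrite leNgt; apply/negP => lt_inf.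
    have [i /andP[fi iS]] := e_dense _ _ lt_inf.
    have {}fi : set_val (f a) < e i by [].
    have {}iS : e i < inf (S (set_val a)) by [].
    have inf2 := infS_le _ _ (S2 (set_val a)).
    have : inf (S (set_val a)) <= e i.
      apply: infS_le; right; exists i; split => //.
        by apply: r_nbhd (Fu _ _ fi) _ _; exists a => /=.
      by apply/andP; split; lra.
    by rewrite leNgt iS.
  apply: lb_le_inf; first by exists 2.
  (* If [e i < f a], then [uG] at the level [f a] itself puts [a] in [G (f a)], that is,
     [f a < f a]. *)
  move=> t [->//|[i [uia _ ->]]]; rewrite leNgt; apply/negP => ltif.
  have := r_nbhd _ _ (uG _ _ ltif) _ uia a erefl.
  by rewrite ltxx.
Qed.

(** * From extension to interpolation *)

Lemma interpolation_of_extension (R : realType) (X : Type)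
    (r : set X -> set X -> Prop) :
  neighbourhood_operator r -> N0 r -> N1 r -> N2 r ->
  (forall (A : set X) (f : set_type A -> set_type (interval22 R)),
    neighbourhood_continuous (induced_neighbourhood r A)
      (topological_neighbourhood (set_type (interval22 R))) f ->
    exists g : X -> set_type (interval22 R),
      neighbourhood_continuous r
        (topological_neighbourhood (set_type (interval22 R))) g /\
      (forall a : set_type A, g (set_val a) = f a)) ->
  N4 r.
Proof.
move=> r_nbhd r_N0 r_N1 r_N2 ext A C rAC.
have AC := r_nbhd _ _ rAC.
have mI (t : R) : -2 <= t <= 2 -> t \in interval22 R.
  by rewrite inE /interval22 /= in_itv.
have m_mem : (-2 : R) \in interval22 R by apply: mI; apply/andP; split; lra.
have p_mem : (2 : R) \in interval22 R by apply: mI; apply/andP; split; lra.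
pose m : set_type (interval22 R) := SigSub m_mem.
pose p : set_type (interval22 R) := SigSub p_mem.
pose f (x : set_type (A `|` ~` C)) := if `[< A (set_val x) >] then m else p.
have fm x : A (set_val x) -> f x = m by rewrite /f => /asboolT ->.
have fp x : ~ A (set_val x) -> f x = p by rewrite /f => /asboolF ->.
have fC : neighbourhood_continuous (induced_neighbourhood r (A `|` ~` C))
    (topological_neighbourhood (set_type (interval22 R))) f.
  move=> S T [U [oU clSU UT]].
  have ST : S `<=` T by move=> t /subset_closure /clSU /UT.
  have [Sm|nSm] := pselect (S m); have [Sp|nSp] := pselect (S p).
  - exists setT; split; first exact: r_N0.
    apply/seteqP; split => // x _ /=; rewrite /f; case: ifP => _; exact: ST.
  - have [Tp|nTp] := pselect (T p).
      exists setT; split; first exact: r_N0.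
      by apply/seteqP; split => // x _ /=; rewrite /f; case: ifP => _ //; exact: ST.
    exists C; split.
      apply: (nbhd_subl r_N1 r_N2 _ rAC) => _ [x /= Sfx <-].
      by apply: contrapT => /fp fxp; rewrite fxp in Sfx.
    apply/seteqP; split => x /=.
      have [/AC//|/fp ->] := pselect (A (set_val x)).
      by [].
    have [Ax|nAx] := pselect (A (set_val x)).
      by rewrite fm// => _; exact: ST.
    by case: (set_valP x).
  - have [Tm|nTm] := pselect (T m).
      exists setT; split; first exact: r_N0.
      by apply/seteqP; split => // x _ /=; rewrite /f; case: ifP => _ //; exact: ST.
    exists (~` A); split.
      apply: (nbhd_subl r_N1 r_N2 _ (r_N1 _ _ rAC)) => _ [x /= Sfx <-] Cx.
      have [Ax|//] := set_valP x.
      by move: Sfx; rewrite fm.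
    apply/seteqP; split => x /=.
      by move=> Tfx Ax; move: Tfx; rewrite fm.
    by move=> /fp ->; exact: ST.
  - exists (set_val @` (f @^-1` T)); split.
      apply: (nbhd_subl r_N1 r_N2 _ (nbhd0 r_N0 r_N1 _)) => _ [x /= Sfx _].
      by move: Sfx; rewrite /f; case: ifP.
    apply/seteqP; split => x /=; first by move=> Tfx; exists x.
    by move=> [y Tfy /val_inj <-].
have [g [gC gf]] := ext _ f fC.
have ltN20 : (-2 : R) < 0 by lra.
have lt01 : (0 : R) < 1 by lra.
(* [A] lies in [{g <= -2}], related to [{g < 0}]; this lies in [{g <= 0}], related to [{g < 1}],
   which is inside [C] because [g] is 2 off [C]. *)
exists [set x | set_val (g x) < 0]; split.
  apply: (nbhd_subl r_N1 r_N2 _ (neighbourhood_continuous_lelt gC ltN20)) => x Ax.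
  have mx : x \in A `|` ~` C by rewrite inE; left.
  by have := gf (SigSub mx); rewrite fm//= => ->.
apply: r_N2 (nbhd_subl r_N1 r_N2 _ (neighbourhood_continuous_lelt gC lt01)) _.
  by move=> x /= /ltW.
move=> x /= gx; apply: contrapT => nCx.
have mx : x \in A `|` ~` C by rewrite inE; right.
have := gf (SigSub mx); rewrite fp//=; last by move=> /AC.
by move=> gxE; move: gx; rewrite gxE /=; lra.
Qed.

Unset Implicit Arguments.

Theorem theorem8p5 (R : realType) (X : Type) (r : set X -> set X -> Prop)
    (r_nbhd : neighbourhood_operator r)
    (r_N0 : N0 r) (r_N1 : N1 r) (r_N2 : N2 r) (r_N3 : N3 r) :
  N4 r <->
  forall (A : set X) (f : set_type A -> set_type (interval22 R)),
    neighbourhood_continuous (induced_neighbourhood r A)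
      (topological_neighbourhood (set_type (interval22 R))) f ->
    exists g : X -> set_type (interval22 R),
      neighbourhood_continuous r
        (topological_neighbourhood (set_type (interval22 R))) g /\
      (forall a : set_type A, g (set_val a) = f a).
Proof.
split; first by move=> r_N4 A f; exact: extension_of_interpolation.
exact: interpolation_of_extension.
Qed.
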